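(* Let $G$ be a simple undirected graph on $n$ vertices with minimum degree $\delta(G)=1$. Then the maximum $\alpha\in(0,1)$ such that $B_\alpha(G)=\alpha A(G)+(1-\alpha)L(G)$ is positive semi-definite is $$\beta_0(G)=\frac{\lambda_n(\mathcal{A})-1}{2\lambda_n(\mathcal{A})-1}.$$
   Context: For a graph $G$ on $n$ vertices, $A(G)$ is the $n\times n$ adjacency matrix, $D=D(G)$ is the diagonal matrix of vertex degrees, $L(G)=D(G)-A(G)$ is the Laplacian matrix, and $\mathcal{A}=\mathcal{A}(G)=D^{-1/2}A(G)D^{-1/2}$ is the normalized adjacency matrix. For a real symmetric $n\times n$ matrix $M$, $\lambda_n(M)$ denotes its smallest eigenvalue. For $\alpha\in[0,1]$, $B_\alpha(G)=\alpha A(G)+(1-\alpha)L(G)$. *)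

(* Defs.v *)
From mathcomp Require Import all_boot all_order all_algebra.
From mathcomp Require Import boolp classical_sets reals.

Set Implicit Arguments.
Unset Strict Implicit.
Unset Printing Implicit Defensive.

Import Order.TTheory GRing.Theory Num.Theory.
Local Open Scope ring_scope.

Record sgraph (n : nat) := SGraph {
  adj : rel 'I_n;
  adj_sym : symmetric adj;
  adj_irrefl : irreflexive adj
}.

Definition degree n (G : sgraph n) (i : 'I_n) : nat := #|[set j | adj G i j]|.

(* A degree is less than [n], so the neutral element [n] never affects the
   minimum when [0 < n]; the graph without vertices gets minimum degree 0. *)
Definition min_degree n (G : sgraph n) : nat :=
  \big[minn/n]_(i < n) degree G i.

Definition adjacency_mx (R : realType) n (G : sgraph n) : 'M[R]_n :=
  \matrix_(i, j) (adj G i j)%:R.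

Definition degree_mx (R : realType) n (G : sgraph n) : 'M[R]_n :=
  diag_mx (\row_i (degree G i)%:R).

Definition laplacian_mx (R : realType) n (G : sgraph n) : 'M[R]_n :=
  degree_mx R G - adjacency_mx R G.

(* D^(-1/2); the entry of an isolated vertex is [0^-1 = 0]. *)
Definition degree_mx_invsqrt (R : realType) n (G : sgraph n) : 'M[R]_n :=
  diag_mx (\row_i (Num.sqrt (degree G i)%:R)^-1).

Definition normalized_adjacency_mx (R : realType) n (G : sgraph n) : 'M[R]_n :=
  degree_mx_invsqrt R G *m adjacency_mx R G *m degree_mx_invsqrt R G.

Definition B_mx (R : realType) n (G : sgraph n) (alpha : R) : 'M[R]_n :=
  alpha *: adjacency_mx R G + (1 - alpha) *: laplacian_mx R G.

Definition is_minimum (R : realType) (A : set R) (m : R) : Prop :=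
  A m /\ lbound A m.

Definition is_maximum (R : realType) (A : set R) (m : R) : Prop :=
  A m /\ ubound A m.

(* The default 0 is reached only if [M] has no eigenvalue in [R], which for a
   symmetric [M] happens only when [n = 0]. *)
Definition lambda_min (R : realType) n (M : 'M[R]_n) : R :=
  xget 0 (is_minimum [set a | eigenvalue M a]%classic).

Definition psd (R : realType) n (M : 'M[R]_n) : Prop :=
  M \is symmetricmx /\ forall x : 'cV[R]_n, 0 <= (x^T *m M *m x) 0 0.

(* Main.v *)
(** With no isolated vertex, congruence by D^(-1/2) turns
    B_alpha = (1 - alpha) D + (2 alpha - 1) A into
    (1 - alpha) I + (2 alpha - 1) N, where N is the normalized adjacency matrix.
    If l is the smallest eigenvalue of N, an eigenvector for l shows that
    positive semi-definiteness forces (1 - alpha) + (2 alpha - 1) l >= 0, that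
    is alpha <= (1 - l) / (1 - 2 l); at equality the matrix is
    (N - l I) / (1 - 2 l), which is positive semi-definite by the minimality of
    l. Since N has zero diagonal and a nonzero entry, l < 0, which places this
    value in (0, 1). *)
Require Import Defs.
From mathcomp Require Import all_boot all_order all_algebra.
From mathcomp Require Import boolp classical_sets reals.
From mathcomp Require Import spectral sesquilinear complex.
From mathcomp Require Import ring lra.

Import Order.TTheory GRing.Theory Num.Theory.
Local Open Scope ring_scope.
Local Open Scope sesquilinear_scope.

Lemma symmetricmxE (R : fieldType) n (M : 'M[R]_n) :
  (M \is symmetricmx) = (M == M^T).
Proof. by rewrite qualifE /= expr0 scale1r map_mx_id. Qed.

(* Diagonalize unitarily over [R[i]]; the eigenvalues are real, hence are
   eigenvalues of [M] over [R]. *)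
Lemma symmetric_min_eigenvalue (R : rcfType) n (M : 'M[R]_n.+1) :
  M \is symmetricmx ->
  exists2 a, eigenvalue M a &
    forall v : 'rV_n.+1, a * (v *m v^T) 0 0 <= (v *m M *m v^T) 0 0.
Proof.
rewrite symmetricmxE => /eqP Msym.
pose toC := real_complex R : {rmorphism R -> R[i]}.
have realC p q (A : 'M[R]_(p, q)) : map_mx toC A \is a realmx.
  by apply/mxOverP => i j; rewrite mxE /toC; apply/complex_realP; exists (A i j).
have Nherm : map_mx toC M \is hermsymmx.
  by apply: realsym_hermsym (realC _ _ _); rewrite symmetricmxE map_trmx -Msym.
have := hermitian_spectral_diag_real Nherm.
have /orthomx_spectralP := hermitian_normalmx Nherm.
have := spectral_unitarymx (map_mx toC M).
move: (spectralmx _) (spectral_diag _) => U d Uu.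
rewrite (invmx_unitary Uu) => Md /mxOverP dreal.
have [rd dE] : exists r : 'I_n.+1 -> R, forall i, d 0 i = (r i)%:C%C.
  by exists (fun i => complex.Re (d 0 i)) => i; rewrite RRe_real.
pose i0 := [arg min_(i < ord0) rd i]%O.
have rd_min i : rd i0 <= rd i by rewrite /i0; case: arg_minP => // j _; apply.
exists (rd i0).
  (* Passing to [R[i]] and back goes through roots of the characteristic polynomial. Over [R[i]],
     row [i0] of [U] is an eigenvector; it is nonzero because the rows of [U] are orthonormal. *)
  rewrite eigenvalue_root_char -(fmorph_root toC) map_char_poly.
  rewrite -eigenvalue_root_char.
  apply/eigenvalueP; exists (row i0 U); last first.
    apply/eqP => /(congr1 (fun z => (z *m U^t*) 0 i0)).
    rewrite -row_mul (unitarymxP Uu) mul0mx !mxE eqxx => /eqP.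
    by rewrite oner_eq0.
  rewrite Md -row_mul !mulmxA (unitarymxP Uu) mul1mx row_mul row_diag_mx.
  by rewrite -scalemxAl -rowE dE.
move=> v; rewrite -lecR.
(* The entries of [w] are the coordinates of [v] in the orthonormal basis of rows of [U]. Both
   quadratic forms become sums of the [|w_i|^2], with weights 1 and [d_i], so the bound holds term
   by term. *)
pose w := map_mx toC v *m U^t*.
have vt : (map_mx toC v)^t* = map_mx toC v^T.
  by rewrite map_trmx realmxC ?realC.
have wt : w^t* = U *m map_mx toC v^T.
  by rewrite /w trmx_mul map_mxM vt trmxCK.
have E1 : ((v *m v^T) 0 0)%:C%C = \sum_i `|w 0 i| ^+ 2.
  rewrite -[_%:C%C]/(toC _).
  transitivity ((w *m w^t*) 0 0).
    by rewrite wt /w mulmxA mulmxKtV // -map_mxM [RHS]mxE.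
  by rewrite mxE; apply: eq_bigr => i _; rewrite !mxE normCK.
have E2 : ((v *m M *m v^T) 0 0)%:C%C = \sum_i d 0 i * `|w 0 i| ^+ 2.
  rewrite -[_%:C%C]/(toC _).
  transitivity ((w *m diag_mx d *m w^t*) 0 0).
    suff -> : w *m diag_mx d *m w^t* = map_mx toC (v *m M *m v^T).
      by rewrite [RHS]mxE.
    by rewrite wt !map_mxM Md /w !mulmxA.
  by rewrite mul_mx_diag mxE; apply: eq_bigr => i _; rewrite !mxE normCK; ring.
rewrite rmorphM /= E1 E2 mulr_sumr; apply: ler_sum => i _.
by rewrite dE ler_wpM2r ?exprn_ge0 // lecR.
Qed.

Lemma dotrV_gt0 (R : realDomainType) n (v : 'rV[R]_n) :
  v != 0 -> 0 < (v *m v^T) 0 0.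
Proof.
move=> v_neq0; rewrite mxE lt_def sumr_ge0 ?andbT; last first.
  by move=> i _; rewrite mxE -expr2 sqr_ge0.
apply: contra v_neq0; rewrite psumr_eq0 => [/allP vv0|i _]; last first.
  by rewrite mxE -expr2 sqr_ge0.
apply/eqP/rowP => i; apply/eqP; rewrite [X in _ == X]mxE -sqrf_eq0 expr2.
by have := vv0 i (mem_index_enum i); rewrite /= mxE.
Qed.

(** Evaluating the quadratic bound at an eigenvector shows that no eigenvalue is below [a]. A
    minimum therefore exists, so [xget] does not return its default, and minima are unique. *)
Lemma lambda_minP (R : realType) n (M : 'M[R]_n.+1) :
  M \is symmetricmx ->
  eigenvalue M (lambda_min M) /\
  forall v : 'rV_n.+1, lambda_min M * (v *m v^T) 0 0 <= (v *m M *m v^T) 0 0.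
Proof.
move=> /symmetric_min_eigenvalue[a Ma a_le].
have a_min : is_minimum [set b | eigenvalue M b]%classic a.
  split=> // b /eigenvalueP[v vM v_neq0].
  by have := a_le v; rewrite vM -scalemxAl [X in _ <= X]mxE ler_pM2r ?dotrV_gt0.
have [Mb b_min] := xgetPex 0 (ex_intro _ a a_min).
suff -> : lambda_min M = a by [].
by apply/eqP; rewrite eq_le b_min // a_min.2.
Qed.

Section Graph.
Variables (R : realType) (n : nat) (G : sgraph n).

Lemma trmx_adjacency_mx : (adjacency_mx R G)^T = adjacency_mx R G.
Proof. by apply/matrixP => i j; rewrite !mxE adj_sym. Qed.

Lemma normalized_adjacency_mx_sym :
  normalized_adjacency_mx R G \is symmetricmx.
Proof.
rewrite symmetricmxE /normalized_adjacency_mx /degree_mx_invsqrt.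
by rewrite !trmx_mul !tr_diag_mx trmx_adjacency_mx mulmxA.
Qed.

Lemma B_mxE (alpha : R) :
  B_mx G alpha =
  (1 - alpha) *: degree_mx R G + (2 * alpha - 1) *: adjacency_mx R G.
Proof. by apply/matrixP => i j; rewrite !mxE; ring. Qed.

Hypothesis degree_gt0 : forall i, (0 < degree G i)%N.

Lemma normalized_B_mx (alpha : R) :
  degree_mx_invsqrt R G *m B_mx G alpha *m degree_mx_invsqrt R G =
  (1 - alpha)%:M + (2 * alpha - 1) *: normalized_adjacency_mx R G.
Proof.
rewrite B_mxE mulmxDr mulmxDl -!scalemxAr -!scalemxAl -scalemx1.
congr (_ *: _ + _); rewrite !mulmx_diag -diag_const_mx; congr diag_mx.
(* Entrywise, [D^(-1/2) D D^(-1/2) = I]; this fails at an isolated vertex, where the entry is 0. *)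
apply/rowP => i; rewrite !mxE mulrAC -invfM -expr2 sqr_sqrtr ?ler0n //.
by rewrite mulVf // pnatr_eq0 -lt0n.
Qed.

Lemma degree_mx_invsqrt_unit : degree_mx_invsqrt R G \in unitmx.
Proof.
rewrite unitmxE det_diag unitfE; apply/prodf_neq0 => i _.
by rewrite mxE invr_eq0 sqrtr_eq0 -ltNge ltr0n.
Qed.

Lemma psd_B_mxP (alpha : R) :
  psd (B_mx G alpha) <->
  forall v : 'rV[R]_n, 0 <= (1 - alpha) * (v *m v^T) 0 0 +
    (2 * alpha - 1) * (v *m normalized_adjacency_mx R G *m v^T) 0 0.
Proof.
have formE (v : 'rV[R]_n) : (v *m degree_mx_invsqrt R G *m B_mx G alpha *m
      (v *m degree_mx_invsqrt R G)^T) 0 0 =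
    (1 - alpha) * (v *m v^T) 0 0 +
    (2 * alpha - 1) * (v *m normalized_adjacency_mx R G *m v^T) 0 0.
  rewrite trmx_mul tr_diag_mx mulmxA -(mulmxA v) -(mulmxA v) normalized_B_mx.
  rewrite mulmxDr mul_mx_scalar mulmxDl -scalemxAr -!scalemxAl.
  by rewrite mxE [X in X + _]mxE [X in _ + X]mxE.
split=> [[_ B_ge0] v|form_ge0].
  by rewrite -formE -{1}[v *m _]trmxK; apply: B_ge0.
split=> [|x].
  rewrite symmetricmxE B_mxE linearD !linearZ /= tr_diag_mx.
  by rewrite trmx_adjacency_mx.
have := form_ge0 (x^T *m invmx (degree_mx_invsqrt R G)).
by rewrite -formE mulmxKV ?degree_mx_invsqrt_unit // trmxK.
Qed.

End Graph.

Lemma min_degree_le n (G : sgraph n) i : (min_degree G <= degree G i)%N.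
Proof.
rewrite /min_degree; have := mem_index_enum i.
elim: (index_enum _) => // j s IHs; rewrite inE big_cons.
by case/predU1P => [<-|/IHs]; rewrite geq_min ?leqnn // => ->; rewrite orbT.
Qed.

Lemma lambda_min_lt0 (R : realType) n (G : sgraph n.+1) :
  (forall i, 0 < degree G i)%N -> lambda_min (normalized_adjacency_mx R G) < 0.
Proof.
move=> deg_gt0; set N := normalized_adjacency_mx R G.
have NE i j : N i j = (Num.sqrt (degree G i)%:R)^-1 * (adj G i j)%:R *
    (Num.sqrt (degree G j)%:R)^-1.
  by rewrite /N /normalized_adjacency_mx mul_mx_diag mul_diag_mx !mxE.
have /card_gt0P[j] := deg_gt0 ord0; rewrite inE => adj0j.
(* Test vector [e_0 - e_j], for [j] a neighbour of [0]. *)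
have [_ /(_ (delta_mx 0 ord0 - delta_mx 0 j))] :=
  lambda_minP _ _ _ (normalized_adjacency_mx_sym R _ G).
have N_gt0 : 0 < N ord0 j.
  by rewrite NE adj0j mulr1 mulr_gt0 // invr_gt0 sqrtr_gt0 ltr0n.
have j_neq0 : (j == ord0) = false.
  by apply/negP => /eqP j0; move: adj0j; rewrite j0 adj_irrefl.
have Nii i : N i i = 0 by rewrite NE adj_irrefl mulr0 mul0r.
have Nj0 : N j ord0 = N ord0 j by rewrite !NE adj_sym; ring.
move: N_gt0 Nii Nj0; rewrite -/N; move: (N) => {NE}M M_gt0 Mii Mj0.
rewrite linearB /= !trmx_delta !mulmxBr !mulmxBl !mul_delta_mx_cond.
rewrite -!rowE -!colE !mxE !Mii Mj0 !eqxx ![ord0 == j]eq_sym j_neq0.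
(* The test vector has squared norm 2 and its form is [- 2 * M ord0 j], whence
   [lambda_min M <= - M ord0 j < 0]. *)
by rewrite !mulr0n !mulr1n !mxE !eqxx /= => lambda_le; lra.
Qed.

Theorem theorem2p4 (R : realType) (n : nat) (G : sgraph n)
    (hdelta : min_degree G = 1%N) :
  let lambda := lambda_min (normalized_adjacency_mx R G) in
  is_maximum [set alpha : R | 0 < alpha < 1 /\ psd (B_mx G alpha)]%classic
    ((lambda - 1) / (2 * lambda - 1)).
Proof.
(* Without vertices the empty minimum is its neutral element [n = 0], contrary to [hdelta]. *)
case: n G hdelta => [|n] G hdelta; first
  by rewrite /min_degree big_ord0 in hdelta.
have deg_gt0 i : (0 < degree G i)%N by rewrite -hdelta min_degree_le.
have := lambda_min_lt0 R _ G deg_gt0.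
have [] := lambda_minP _ _ _ (normalized_adjacency_mx_sym R _ G).
move: (lambda_min _) => {hdelta}lambda lambda_eig lambda_le lambda_lt0 /=.
have den_gt0 : 0 < 1 - 2 * lambda by lra.
(* Both signs are flipped so that the denominator is positive and inequalities can be multiplied by
   it. *)
have -> : (lambda - 1) / (2 * lambda - 1) = (1 - lambda) / (1 - 2 * lambda).
  by field; lra.
split=> /= [|alpha [_ /(psd_B_mxP _ _ _ deg_gt0) B_ge0]].
  split; first by rewrite divr_gt0 ?ltr_pdivrMr //; lra.
  apply/(psd_B_mxP _ _ _ deg_gt0) => v.
  have -> : 1 - (1 - lambda) / (1 - 2 * lambda) = - lambda / (1 - 2 * lambda).
    by field; lra.
  have -> : 2 * ((1 - lambda) / (1 - 2 * lambda)) - 1 = (1 - 2 * lambda)^-1.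
    by field; lra.
  rewrite mulrAC mulrC -mulrDr mulr_ge0 ?invr_ge0 ?(ltW den_gt0) //.
  by rewrite mulNr addrC subr_ge0.
have /eigenvalueP[v vN v_neq0] := lambda_eig.
have := B_ge0 v; rewrite vN -scalemxAl [(_ *: _ : matrix _ _ _) 0 0]mxE.
(* Cancelling [v v^T > 0] leaves [0 <= 1 - alpha + (2 * alpha - 1) * lambda], which is linear in
   [alpha]. *)
rewrite mulrA -mulrDl pmulr_lge0 ?dotrV_gt0 // ler_pdivlMr // => le0; lra.
Qed.
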